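(* Given a proof net ρ, there exists a derivation π in MLL^{0,2}_{hyp} such that ρ is isomorphic to D(π); such a π is called a sequentialization of ρ.
   Context: MLL^{0,2}_{hyp} is the sequent calculus of unit-free multiplicative linear logic (formulas built from atoms X, X^⊥ with ⊗ and ⅋) with rules: ax (⊢ A^⊥, A), cut, ⊗, ⅋, mix_2 (from ⊢ Γ and ⊢ Δ derive ⊢ Γ, Δ), mix_0 (⊢ with empty sequent), and hyp (⊢ A for any single formula A, an open hypothesis). A proof structure is a directed acyclic partial graph (each edge has an optional source and an optional target) whose vertices are labeled ax, cut, ⊗ or ⅋: each ax-vertex has two conclusions and no premise, each cut-vertex has two premises and no conclusion, each ⊗-vertex and each ⅋-vertex has two premises and one conclusion; edges are labeled by formulas subject to the usual typing constraints; edges with no source (resp. no target) are the premises (resp. conclusions) of the structure. Paths are taken in the underlying undirected partial graph; a cycle is a non-empty simple closed path; a path is switching when it does not contain both premises of any ⅋-vertex; a proof net is a proof structure with no switching cycle. The desequentialization D(π) is defined by induction on π: an ax rule gives a single ax-vertex with its two conclusions; cut, ⊗, ⅋ rules add a cut-, ⊗- or ⅋-vertex on the edges of the principal formulas of the translated sub-derivations (with a new conclusion edge for ⊗ and ⅋); mix_2 is the disjoint union of the translations; mix_0 gives the empty graph; hyp on ⊢ A gives a single edge labeled A with no endpoint. *)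

(* Defs.v *)
From mathcomp Require Import all_boot.
Set Implicit Arguments.
Unset Strict Implicit.
Unset Printing Implicit Defensive.

Inductive formula (atom : Type) : Type :=
| Pos of atom
| Neg of atom
| Tens of formula atom & formula atom
| Parr of formula atom & formula atom.

Fixpoint dual (atom : Type) (A : formula atom) : formula atom :=
  match A with
  | Pos X => Neg X
  | Neg X => Pos X
  | Tens B C => Parr (dual B) (dual C)
  | Parr B C => Tens (dual B) (dual C)
  end.

(** * Proof structures *)

Inductive vlabel : Type := v_ax | v_cut | v_tens | v_parr.

(* Finite directed partial multigraphs with labels.  The boolean [eleft e]
   tells whether [e] is the left or the right premise of its target; it is
   meaningful only when that target is a tensor or a par, and isomorphisms
   ignore it elsewhere. *)
Record pgraph (atom : Type) : Type := PGraph {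
  vertex : finType;
  edge : finType;
  src : edge -> option vertex;
  tgt : edge -> option vertex;
  vlab : vertex -> vlabel;
  elab : edge -> formula atom;
  eleft : edge -> bool
}.

Definition premises (atom : Type) (G : pgraph atom) (v : vertex G) :
  {set edge G} := [set e | tgt e == Some v].

Definition conclusions (atom : Type) (G : pgraph atom) (v : vertex G) :
  {set edge G} := [set e | src e == Some v].

Definition well_typed_bin (atom : Type) (G : pgraph atom) (v : vertex G)
    (op : formula atom -> formula atom -> formula atom) : Prop :=
  exists l r c : edge G,
    [/\ eleft l, ~~ eleft r, premises v = [set l; r], conclusions v = [set c]
      & elab c = op (elab l) (elab r)].

Definition well_typed (atom : Type) (G : pgraph atom) (v : vertex G) : Prop :=
  match vlab v with
  | v_ax => premises v = set0 /\
      exists e e' : edge G,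
        [/\ e != e', conclusions v = [set e; e'] & elab e = dual (elab e')]
  | v_cut => conclusions v = set0 /\
      exists e e' : edge G,
        [/\ e != e', premises v = [set e; e'] & elab e = dual (elab e')]
  | v_tens => well_typed_bin v (@Tens atom)
  | v_parr => well_typed_bin v (@Parr atom)
  end.

Definition arrow (atom : Type) (G : pgraph atom) : rel (vertex G) :=
  fun x y => [exists e : edge G, (src e == Some x) && (tgt e == Some y)].

Definition directed_acyclic (atom : Type) (G : pgraph atom) : Prop :=
  forall p : seq (vertex G), cycle (@arrow atom G) p -> p = [::].

Definition proof_structure (atom : Type) (G : pgraph atom) : Prop :=
  directed_acyclic G /\ forall v : vertex G, well_typed v.

(** * Undirected paths and proof nets *)

Definition joins (atom : Type) (G : pgraph atom) (e : edge G)
    (x y : vertex G) : bool :=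
  (src e == Some x) && (tgt e == Some y) ||
  (src e == Some y) && (tgt e == Some x).

(* The path x, e1, v1, ..., en, vn is encoded by its starting vertex x and the
   sequence (e1, v1), ..., (en, vn). *)
Fixpoint upath (atom : Type) (G : pgraph atom) (x : vertex G)
    (p : seq (edge G * vertex G)) : bool :=
  if p is (e, y) :: p' then joins e x y && upath y p' else true.

(* Edges are pairwise distinct, and so are vertices except that the two
   endpoints may coincide. *)
Definition simple_path (atom : Type) (G : pgraph atom) (x : vertex G)
    (p : seq (edge G * vertex G)) : bool :=
  [&& uniq (unzip1 p), uniq (unzip2 p) & uniq (belast x (unzip2 p))].

Definition undirected_cycle (atom : Type) (G : pgraph atom) (x : vertex G)
    (p : seq (edge G * vertex G)) : bool :=
  [&& p != [::], upath x p, simple_path x p & last x (unzip2 p) == x].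

Definition switching (atom : Type) (G : pgraph atom)
    (p : seq (edge G * vertex G)) : Prop :=
  forall (v : vertex G) (e e' : edge G),
    vlab v = v_parr -> e \in premises v -> e' \in premises v -> e != e' ->
    ~ (e \in unzip1 p /\ e' \in unzip1 p).

Definition proof_net (atom : Type) (G : pgraph atom) : Prop :=
  proof_structure G /\
  forall (x : vertex G) (p : seq (edge G * vertex G)),
    undirected_cycle x p -> ~ switching p.

Definition isomorphic (atom : Type) (G H : pgraph atom) : Prop :=
  exists (f : vertex G -> vertex H) (g : edge G -> edge H),
    [/\ bijective f /\ bijective g,
        forall e, src (g e) = omap f (src e) /\ tgt (g e) = omap f (tgt e),
        forall v, vlab (f v) = vlab v,
        forall e, elab (g e) = elab e
      & forall v e, vlab v = v_tens \/ vlab v = v_parr ->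
          e \in premises v -> eleft (g e) = eleft e].

(** * Sequent calculus *)

(* A sequent is a finite family of formula occurrences; occurrences are named
   rather than listed, which makes the exchange rule implicit. *)
Record sequent (atom : Type) : Type := Sequent {
  occ : finType;
  fml :> occ -> formula atom
}.

Definition seq_empty (atom : Type) : sequent atom :=
  @Sequent atom void (@of_void _).

Definition seq_single (atom : Type) (A : formula atom) : sequent atom :=
  @Sequent atom unit (fun=> A).

Definition seq_ax (atom : Type) (A : formula atom) : sequent atom :=
  @Sequent atom bool (fun b => if b then A else dual A).

Definition seq_cat (atom : Type) (Gam Del : sequent atom) : sequent atom :=
  @Sequent atom (occ Gam + occ Del)%type
    (fun x => match x with inl i => Gam i | inr j => Del j end).

Definition seq_cons (atom : Type) (A : formula atom) (Gam : sequent atom) :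
  sequent atom := @Sequent atom (option (occ Gam)) (oapp Gam A).

Definition seq_rem (atom : Type) (Gam : sequent atom) (i : occ Gam) :
  sequent atom := @Sequent atom {x : occ Gam | x != i} (fun x => Gam (val x)).

Definition seq_rem2 (atom : Type) (Gam : sequent atom) (i j : occ Gam) :
  sequent atom :=
  @Sequent atom {x : occ Gam | (x != i) && (x != j)} (fun x => Gam (val x)).

(* The arguments [i] and [j] are the principal occurrences of the rule. *)
Inductive deriv (atom : Type) : sequent atom -> Type :=
| r_ax (A : formula atom) : deriv (seq_ax A)
| r_cut (Gam Del : sequent atom) (i : occ Gam) (j : occ Del) :
    Del j = dual (Gam i) -> deriv Gam -> deriv Del ->
    deriv (seq_cat (seq_rem i) (seq_rem j))
| r_tens (Gam Del : sequent atom) (i : occ Gam) (j : occ Del) :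
    deriv Gam -> deriv Del ->
    deriv (seq_cons (Tens (Gam i) (Del j))
                    (seq_cat (seq_rem i) (seq_rem j)))
| r_parr (Gam : sequent atom) (i j : occ Gam) :
    i != j -> deriv Gam ->
    deriv (seq_cons (Parr (Gam i) (Gam j)) (seq_rem2 i j))
| r_mix2 (Gam Del : sequent atom) :
    deriv Gam -> deriv Del -> deriv (seq_cat Gam Del)
| r_mix0 : deriv (seq_empty atom)
| r_hyp (A : formula atom) : deriv (seq_single A).

(** * Desequentialization *)

Definition g_empty (atom : Type) : pgraph atom :=
  @PGraph atom void void (@of_void _) (@of_void _)
    (@of_void _) (@of_void _) (@of_void _).

Definition g_ax (atom : Type) (A : formula atom) : pgraph atom :=
  @PGraph atom unit bool (fun=> Some tt) (fun=> None)
    (fun=> v_ax) (fun b => if b then A else dual A) (fun=> true).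

Definition g_hyp (atom : Type) (A : formula atom) : pgraph atom :=
  @PGraph atom void unit (fun=> None) (fun=> None)
    (@of_void _) (fun=> A) (fun=> true).

Definition g_union (atom : Type) (G H : pgraph atom) : pgraph atom :=
  @PGraph atom (vertex G + vertex H)%type (edge G + edge H)%type
    (fun e => match e with
              | inl e => omap inl (src e) | inr e => omap inr (src e) end)
    (fun e => match e with
              | inl e => omap inl (tgt e) | inr e => omap inr (tgt e) end)
    (fun v => match v with inl v => vlab v | inr v => vlab v end)
    (fun e => match e with inl e => elab e | inr e => elab e end)
    (fun e => match e with inl e => eleft e | inr e => eleft e end).

(* [None] is the new vertex. *)
Definition g_cut (atom : Type) (G : pgraph atom) (e1 e2 : edge G) :
  pgraph atom :=
  @PGraph atom (option (vertex G)) (edge G)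
    (fun e => omap Some (src e))
    (fun e => if (e == e1) || (e == e2) then Some None
              else omap Some (tgt e))
    (oapp (@vlab atom G) v_cut)
    (@elab atom G)
    (@eleft atom G).

(* [None] is the new vertex, resp. the new edge. *)
Definition g_bin (atom : Type) (k : vlabel) (C : formula atom)
    (G : pgraph atom) (l r : edge G) : pgraph atom :=
  @PGraph atom (option (vertex G)) (option (edge G))
    (fun oe => if oe is Some e then omap Some (src e) else Some None)
    (fun oe => if oe is Some e then
                 if (e == l) || (e == r) then Some None
                 else omap Some (tgt e)
               else None)
    (oapp (@vlab atom G) k)
    (oapp (@elab atom G) C)
    (fun oe => if oe is Some e then
                 if e == l then true else if e == r then false else eleft e
               else true).

(* A graph together with the conclusion edge of each formula occurrence. *)
Record cgraph (atom : Type) (I : finType) : Type := CGraph {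
  cgraph_graph :> pgraph atom;
  concl : I -> edge cgraph_graph
}.

Fixpoint deseq (atom : Type) (Gam : sequent atom) (pi : deriv Gam) :
  cgraph atom (occ Gam) :=
  match pi in deriv Gam return cgraph atom (occ Gam) with
  | r_ax A => @CGraph atom (occ (seq_ax A)) (g_ax A) id
  | @r_cut _ Gam Del i j _ p q =>
      let G := deseq p in let H := deseq q in
      @CGraph atom (occ (seq_cat (seq_rem i) (seq_rem j)))
        (@g_cut atom (g_union G H) (inl (concl G i)) (inr (concl H j)))
        (fun x => match x with
                  | inl y => inl (concl G (val y))
                  | inr y => inr (concl H (val y))
                  end)
  | @r_tens _ Gam Del i j p q =>
      let G := deseq p in let H := deseq q in
      let C := Tens (Gam i) (Del j) in
      @CGraph atom (occ (seq_cons C (seq_cat (seq_rem i) (seq_rem j))))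
        (@g_bin atom v_tens C (g_union G H)
                (inl (concl G i)) (inr (concl H j)))
        (omap (fun x => match x with
                        | inl y => inl (concl G (val y))
                        | inr y => inr (concl H (val y))
                        end))
  | @r_parr _ Gam i j _ p =>
      let G := deseq p in
      let C := Parr (Gam i) (Gam j) in
      @CGraph atom (occ (seq_cons C (seq_rem2 i j)))
        (g_bin v_parr C (concl G i) (concl G j))
        (omap (fun y => concl G (val y)))
  | @r_mix2 _ Gam Del p q =>
      let G := deseq p in let H := deseq q in
      @CGraph atom (occ (seq_cat Gam Del)) (g_union G H)
        (fun x => match x with
                  | inl y => inl (concl G y)
                  | inr y => inr (concl H y)
                  end)
  | r_mix0 => @CGraph atom (occ (seq_empty atom)) (g_empty atom) (@of_void _)
  | r_hyp A => @CGraph atom (occ (seq_single A)) (g_hyp A) id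
  end.

(* Main.v *)
Require Import Defs.
From mathcomp Require Import all_boot zify.

Set Implicit Arguments.
Unset Strict Implicit.
Unset Printing Implicit Defensive.

(* A proof net with a vertex has a terminal vertex that is a par or that is
   splitting, i.e. whose removal disconnects its premises; undoing the
   corresponding last rule yields smaller proof nets. To find it, we follow the
   proof of Yeo's theorem by cusp minimisation. For an edge e with target v, let
   R(e) be the set of vertices reachable from v by a simple path that, continued
   from e, never takes two premises of the same par consecutively (a cusp).
   If v is not terminal, R(f) is strictly smaller than R(e), where f is the
   conclusion of v. If v is terminal but neither a par nor splitting, there is
   a cycle without cusp at v; take one with as few cusps as possible, leaving v
   by the premise other than e. By correctness it has a cusp; let g be the edge
   along which it reaches the first one, at a vertex u. A path witnessing
   R(g) cannot meet the cycle again, since it would provide a cycle through v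
   with fewer cusps or a cycle without cusps, so R(g) is strictly smaller than
   R(e). *)

(** * Terminal splitting vertices *)

Section Paths.
Variables (atom : Type) (G : pgraph atom).
Implicit Types (e f g h : edge G) (x y z u v w : vertex G).
Implicit Types (p q s : seq (edge G * vertex G)) (r : seq (edge G)).

(** * Endpoints, cusps and undirected paths *)

Lemma joins_sym e x y : joins e x y = joins e y x.
Proof. by rewrite /joins orbC. Qed.

Lemma joins_inj e x y x' y' : joins e x y -> joins e x' y' ->
  (x = x' /\ y = y') \/ (x = y' /\ y = x').
Proof.
by case/orP=> /andP[/eqP E1 /eqP E2] /orP[]/andP[]; rewrite E1 E2 => /eqP[->] /eqP[->];
  [left|right|right|left].
Qed.

Lemma joins_tgt e x y z : joins e x y -> tgt e = Some z -> z = x \/ z = y.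
Proof. by case/orP=> /andP[_ /eqP->] [->]; [right|left]. Qed.

Definition is_parr v : bool := if vlab v is v_parr then true else false.

Lemma is_parrP v : reflect (vlab v = v_parr) (is_parr v).
Proof. by rewrite /is_parr; case: (vlab v); constructor. Qed.

(** The clause [e == f] makes this an equivalence relation, so that smoothness also forbids
    backtracking along an edge. An edge without target is related only to itself. *)
Definition cusp : rel (edge G) :=
  fun e f => (e == f) || (tgt e == tgt f) && (if tgt e is Some v then is_parr v else false).

Definition smooth : rel (edge G) := fun e f => ~~ cusp e f.

Lemma cuspxx e : cusp e e.
Proof. by rewrite /cusp eqxx. Qed.

Lemma cusp_sym e f : cusp e f = cusp f e.
Proof.
rewrite /cusp eq_sym [tgt f == _]eq_sym; case: (f == e) => //=.
by case: eqP => [->|].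
Qed.

Lemma smooth_sym e f : smooth e f = smooth f e.
Proof. by rewrite /smooth cusp_sym. Qed.

Lemma cusp_trans f e g : cusp e f -> cusp f g -> cusp e g.
Proof.
rewrite /cusp; case: (eqVneq e f) => [->//|_] /= /andP[/eqP->  h].
by case: (eqVneq f g) => [<-|_] /=; rewrite h ?andbT ?eqxx ?orbT //= => ->; rewrite orbT.
Qed.

Lemma cuspP e f : cusp e f -> e = f \/ exists2 v, tgt e = Some v & tgt f = Some v.
Proof.
case/orP => [/eqP->|/andP[/eqP <-]]; first by left.
by case: (tgt e) => // v _; right; exists v.
Qed.

Lemma upath_cat x p q :
  upath x (p ++ q) = upath x p && upath (last x (unzip2 p)) q.
Proof. by elim: p x => //= -[e y] p IH x; rewrite IH andbA. Qed.

Lemma unzip1_cat p q : unzip1 (p ++ q) = unzip1 p ++ unzip1 q.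
Proof. exact: map_cat. Qed.

Lemma unzip2_cat p q : unzip2 (p ++ q) = unzip2 p ++ unzip2 q.
Proof. exact: map_cat. Qed.

Lemma upath_rev x p : upath x p -> exists p',
  [/\ upath (last x (unzip2 p)) p', unzip1 p' = rev (unzip1 p)
    & unzip2 p' = rev (belast x (unzip2 p))].
Proof.
elim: p x => [|[e y] p IH] x /=; first by exists [::].
case/andP=> je /IH[p' [up' E1 E2]]; exists (p' ++ [:: (e, x)]).
rewrite upath_cat unzip1_cat unzip2_cat E1 E2 up' /= !rev_cons !cats1.
split=> //; rewrite andbT.
by case: (p) => [|[e' y'] p1] /=; rewrite ?rev_cons ?last_rcons joins_sym.
Qed.

Lemma upath_nth x0 e0 x p i : upath x p -> i < size p ->
  joins (nth e0 (unzip1 p) i) (nth x0 (x :: unzip2 p) i) (nth x0 (unzip2 p) i).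
Proof.
by elim: p x i => //= -[e y] p IH x [|i] /andP[je up]//=; apply: IH.
Qed.

(** Only the vertices are required to be distinct; distinctness of the edges will follow from cyclic
    smoothness. *)
Definition closed_path v p : bool :=
  [&& p != [::], upath v p, last v (unzip2 p) == v & uniq (unzip2 p)].

Lemma belast_perm v (s : seq (vertex G)) : last v s = v -> perm_eq (belast v s) s.
Proof.
move=> lv; rewrite -(perm_cons v).
by rewrite perm_sym {1}lastI lv -cats1 perm_catC.
Qed.

Hypothesis netG : proof_net G.

(* Distinct edges of a simple cycle sharing an endpoint are cyclically
   consecutive, so smoothness of consecutive edges is the switching condition. *)
Lemma closed_path_cusp v p : closed_path v p -> ~~ cycle smooth (unzip1 p).
Proof.
case/and4P=> p0 up /eqP lv uq; apply/negP => cyc.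
have pw : pairwise smooth (unzip1 p).
  case: p p0 up lv uq cyc => // -[e0 y0] p _; set q := (e0, y0) :: p => up lv uq.
  rewrite [cycle _ _]/= => cyc.
  have sz : size (unzip1 q) = size q by rewrite size_map.
  have sz2 : size (unzip2 q) = size q by rewrite size_map.
  have Xi i j : i < j <= size q ->
      nth v (v :: unzip2 q) i = nth v (v :: unzip2 q) j -> i = 0 /\ j = size q.
    case: j => [|j]; first by lia.
    case: i => [|i] /andP[ij jn] H; last first.
      by move/eqP: H; rewrite -[nth _ _ i.+1]/(nth v (unzip2 q) i)
        -[nth _ _ j.+1]/(nth v (unzip2 q) j) nth_uniq ?sz2 //; lia.
    split=> //; move/eqP: H; rewrite -[nth _ (v :: _) 0]/v -[nth _ _ j.+1]/(nth v (unzip2 q) j).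
    by rewrite -{1}lv -nth_last nth_uniq ?sz2 //; lia.
  apply/(pairwiseP e0) => i j; rewrite !inE sz => iq jq ij.
  rewrite /smooth; apply/negP => c.
  have ji := upath_nth v e0 up iq; have jj := upath_nth v e0 up jq.
  have cons : i.+1 = j -> False.
    move=> E; move/(pathP e0)/(_ i): cyc; rewrite size_rcons.
    have -> : nth e0 (e0 :: rcons (unzip1 p) e0) i = nth e0 (unzip1 q) i.
      by rewrite -rcons_cons nth_rcons sz iq.
    have -> : nth e0 (rcons (unzip1 p) e0) i = nth e0 (unzip1 q) j.
      rewrite -E /= nth_rcons; case: ltnP => //; move: jq; rewrite -E /= size_map; lia.
    by rewrite size_map -[(size p).+1]/(size q) => /(_ iq)/negP; apply.
  have wrap : i = 0 -> j.+1 = size q -> False.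
    move=> i0 E; move/(pathP e0)/(_ j): cyc; rewrite size_rcons.
    have -> : nth e0 (e0 :: rcons (unzip1 p) e0) j = nth e0 (unzip1 q) j.
      by rewrite -rcons_cons nth_rcons sz jq.
    have -> : nth e0 (rcons (unzip1 p) e0) j = e0.
      rewrite nth_rcons size_map; case: ltngtP => //; move: E => /=; lia.
    rewrite size_map -[(size p).+1]/(size q) => /(_ jq)/negP.
    by apply; rewrite cusp_sym; move: c; rewrite i0.
  (* Two edges in a cusp share an endpoint. Edge [i] joins the vertices of index [i] and [i.+1], so
     [Xi] leaves two of the four coincidences: consecutive edges, and the last edge with the
     first. *)
  have shared : [\/ nth v (v :: unzip2 q) i = nth v (v :: unzip2 q) j,
      nth v (v :: unzip2 q) i = nth v (unzip2 q) j,
      nth v (unzip2 q) i = nth v (v :: unzip2 q) j |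
      nth v (unzip2 q) i = nth v (unzip2 q) j].
    case/cuspP: c => [Eij|[z zi zj]].
      rewrite -Eij in jj; case: (joins_inj ji jj) => -[] -> ->; by constructor.
    case: (joins_tgt ji zi) => <-; case: (joins_tgt jj zj) => <-; by constructor.
  case: shared => Esh.
  - by case: (@Xi i j) => //; lia.
  - have [i0 jn] : i = 0 /\ j.+1 = size q by apply: Xi => //; lia.
    exact: wrap.
  - have [E'|ne] := eqVneq i.+1 j; first exact: cons.
    case: (@Xi i.+1 j) => //; lia.
  - by case: (@Xi i.+1 j.+1) => //; lia.
have sw : forall e e', e \in unzip1 p -> e' \in unzip1 p -> e != e' -> smooth e e'.
  move=> e e' ein; have := pw.
  case/splitPr: ein => p1 p2; rewrite pairwise_cat /= => /and3P[/allrelP r1 _ /andP[/allP r2 _]].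
  rewrite mem_cat inE => /or3P[i|/eqP->|i]; rewrite ?eqxx // => _.
    by rewrite smooth_sym r1 // mem_head.
  exact: r2.
case: netG => _ /(_ v p); apply.
  rewrite /undirected_cycle /simple_path p0 up uq lv eqxx !andbT.
  rewrite (perm_uniq (belast_perm lv)) uq andbT /=.
  rewrite uniq_pairwise andbT; apply: sub_pairwise pw => e f.
  by apply: contraNneq => ->; rewrite cuspxx.
move=> u e e' /is_parrP pu; rewrite !inE => /eqP te /eqP te' ne [/sw s1 /s1 /(_ ne)].
by rewrite /smooth /cusp te te' pu eqxx orbT.
Qed.


(** * Counting cusps along a loop *)

Fixpoint ncusp e r : nat := if r is f :: r' then cusp e f + ncusp f r' else 0.

Lemma ncusp_cat e r r' : ncusp e (r ++ r') = ncusp e r + ncusp (last e r) r'.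
Proof. by elim: r e => //= f r IH e; rewrite IH addnA. Qed.

Lemma ncusp0 e r : (ncusp e r == 0) = path smooth e r.
Proof. by elim: r e => //= f r IH e; rewrite addn_eq0 eqb0 IH. Qed.

Lemma last_rev_belast e r : last (last e r) (rev (belast e r)) = e.
Proof. by case: r => //= f r; rewrite rev_cons last_rcons. Qed.

Lemma ncusp_rev e r : ncusp (last e r) (rev (belast e r)) = ncusp e r.
Proof.
elim: r e => //= f r IH e.
by rewrite rev_cons -cats1 ncusp_cat IH last_rev_belast /= cusp_sym addn0 addnC.
Qed.

Lemma rev_cons_last e r : rev (e :: r) = last e r :: rev (belast e r).
Proof. by rewrite lastI rev_rcons. Qed.

(** The pair formed by the last and the first edge is not counted; it is left to [smooth_ends]. *)
Definition cusps r : nat := if r is e :: r' then ncusp e r' else 0.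

Definition smooth_ends r : bool := if r is e :: r' then smooth (last e r') e else false.

Lemma cusps_rev r : cusps (rev r) = cusps r.
Proof. by case: r => // e r; rewrite rev_cons_last /= ncusp_rev. Qed.

Lemma smooth_ends_rev r : smooth_ends (rev r) = smooth_ends r.
Proof. by case: r => // e r; rewrite rev_cons_last /= last_rev_belast smooth_sym. Qed.

Definition loop_at v p := closed_path v p && smooth_ends (unzip1 p).

Lemma loop_rev v p : loop_at v p -> exists p',
  [/\ loop_at v p', unzip1 p' = rev (unzip1 p) & unzip2 p' = rev (belast v (unzip2 p))].
Proof.
case/andP=> /and4P[p0 up /eqP lv uq] se.
have [p' [up' E1 E2]] := upath_rev up.
rewrite lv in up'; exists p'; split=> //.
rewrite /loop_at E1 smooth_ends_rev se andbT /closed_path up' E2 rev_uniq.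
rewrite (perm_uniq (belast_perm lv)) uq andbT /=.
case: p p0 E1 E2 {se up uq lv} => // -[e y] p _ E1 E2.
rewrite /= rev_cons last_rcons eqxx andbT.
by apply/eqP => p'0; move: E1; rewrite p'0 /= rev_cons; case: (rev _).
Qed.

Lemma cusp_count m n (b c : bool) : (m + (c + n)).+1 <= b + n -> [/\ m = 0, b & ~~ c].
Proof. by case: b; case: c => h; split=> //; move: h; rewrite ?add0n ?add1n; lia. Qed.

(* Replacing [B1] by [q] removes the cusp (g, h) and creates at most the one
   at [w]; if the number of cusps did not drop, then [B1] followed by the
   reverse of [q] would be a cycle without cusps. *)
Lemma loop_reroute v A B1 B2 q a rA h rB (s : seq (vertex G)) u w f rq :
  let g := last a rA in
  loop_at v (A ++ B1 ++ B2) ->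
  unzip1 A = a :: rA -> unzip1 B1 = h :: rB -> cusp g h ->
  u = last v (unzip2 A) -> w = last u (unzip2 B1) ->
  upath u q -> unzip1 q = f :: rq -> unzip2 q = rcons s w ->
  path smooth g (unzip1 q) -> uniq s ->
  ~~ has [in unzip2 (A ++ B1 ++ B2)] s ->
  (B2 = [::] -> smooth (last f rq) a) ->
  loop_at v (A ++ q ++ B2) /\
  cusps (unzip1 (A ++ q ++ B2)) < cusps (unzip1 (A ++ B1 ++ B2)).
Proof.
move=> g /andP[/and4P[_ up lv uq] se] EA EB gh Eu Ew uqq Eq Es sm us sdis sB2.
move: up lv uq se sdis; rewrite !upath_cat !unzip1_cat !unzip2_cat !last_cat -Eu -Ew.
case/and3P=> upA upB1 upB2 lv uq se sdis.
have lq : last u (unzip2 q) = w by rewrite Es last_rcons.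
have wB1 : w \in unzip2 B1.
  by rewrite Ew; case: (B1) EB => //= -[? ?] ? _; rewrite /= mem_last.
have uA : u \in unzip2 A.
  by rewrite Eu; case: (A) EA => //= -[? ?] ? _; rewrite /= mem_last.
split.
  apply/andP; split.
    apply/and4P; split.
    - by case: (A) EA.
    - by rewrite !upath_cat -Eu lq upA uqq upB2.
    - by rewrite !unzip2_cat !last_cat -Eu lq.
    rewrite !unzip2_cat Es -cats1 -catA.
    rewrite uniq_catCA cat_uniq us /=.
    have -> /= : ~~ has [in s] (unzip2 A ++ w :: unzip2 B2).
      rewrite has_sym; apply: contra sdis; apply: sub_has => z /=.
      rewrite !mem_cat inE => /or3P[->//|/eqP->|->]; by rewrite ?wB1 ?orbT.
    apply: subseq_uniq uq; apply: cat_subseq => //.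
    by rewrite -cat1s; apply: cat_subseq => //; rewrite sub1seq.
  rewrite !unzip1_cat EA Eq; move: se; rewrite EA EB /= !last_cat /=.
  case: (B2) sB2 => [|[d y] B2'] sB2; last by rewrite !last_cat.
  by rewrite /= !cats0 => _; exact: sB2.
have smq : ncusp g (unzip1 q) = 0 by apply/eqP; rewrite ncusp0.
rewrite EA EB Eq /= !ncusp_cat /= -/g gh ncusp_cat.
move: smq; rewrite Eq /= => /eqP; rewrite addn_eq0 => /andP[gf rq0].
rewrite (eqP gf) (eqP rq0) !add0n ltn_add2l add1n.
rewrite ltnNge; apply/negP => le.
have [rB0 [d [rB2 [EB2 cd scd]]]] : ncusp h rB = 0 /\ exists d rB2,
   [/\ unzip1 B2 = d :: rB2, cusp (last f rq) d & smooth (last h rB) d].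
  move: le; case: (unzip1 B2) => [|d rB2] //=.
  rewrite ncusp_cat /= => /cusp_count; case=> rB0 c1 c2.
  by split=> //; exists d, rB2.
(* At [w], the edge [d] forms a cusp with the last edge of [q] but not with that of [B1]; by
   transitivity these two last edges form no cusp. *)
have sfb : smooth (last h rB) (last f rq).
  by apply: contra scd => /cusp_trans; apply.
have [q' [upq' E1 E2]] := upath_rev uqq.
have cl : closed_path u (B1 ++ q').
  apply/and4P; split.
  - by case: (B1) EB.
  - by rewrite upath_cat upB1 -Ew -lq.
  - rewrite unzip2_cat last_cat -Ew E2 Es belast_rcons rev_cons last_rcons //.
  rewrite unzip2_cat E2 Es belast_rcons.
  have uS : u \notin s.
    by apply: contra sdis => us'; apply/hasP; exists u; rewrite //= mem_cat uA.
  rewrite cat_uniq rev_uniq /= uS us has_rev /= negb_or.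
  move: (uq); rewrite cat_uniq => /and3P[_ /hasPn dA]; rewrite cat_uniq => /andP[-> _].
  have -> /= : u \notin unzip2 B1.
    by apply/negP => uB; move: (dA u); rewrite mem_cat uB uA => /(_ isT).
  rewrite andbT; apply: contra sdis; apply: sub_has => z /= zB.
  by rewrite !mem_cat zB orbT.
apply/negP: (closed_path_cusp cl); rewrite negbK.
rewrite unzip1_cat EB E1 Eq rev_cons_last /= rcons_cat cat_path /= sfb.
rewrite -cats1 cat_path last_rev_belast /= andbT -!ncusp0 ncusp_rev rB0 (eqP rq0) /=.
(* At [u], a cusp of [h] with [f] would make [g] and [f] a cusp through [h], against the smoothness
   of [q] after [g]. *)
rewrite smooth_sym; apply/negP => hf; move: gf; rewrite eqb0 => /negP; apply.
exact: cusp_trans gh hf.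
Qed.

(* The alternative with [q] is applied to the loop or to its reverse,
   according to which of the two arcs it hits first. *)
Lemma loop_reduce v A B q0 :
  let u := last v (unzip2 A) in
  loop_at v (A ++ B) -> 
  forall a rA h rB f rq, unzip1 A = a :: rA -> unzip1 B = h :: rB ->
  cusp (last a rA) h ->
  upath u q0 -> unzip1 q0 = f :: rq -> path smooth (last a rA) (unzip1 q0) ->
  uniq (u :: unzip2 q0) -> has [in unzip2 (A ++ B)] (unzip2 q0) ->
  exists p, loop_at v p /\ cusps (unzip1 p) < cusps (unzip1 (A ++ B)).
Proof.
move=> u lp a rA h rB f0 rq0 EA EB gh upq _ smq uq hq.
have {hq} hq : has [pred x | x.2 \in unzip2 (A ++ B)] q0.
  by case/hasP: hq => z /mapP[x xq ->] xin; apply/hasP; exists x.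
(* Only the part of [q0] up to its first vertex [w] on the loop is kept, so that its inner vertices
   avoid the loop. *)
case/split_find: hq upq smq uq => -[f w] q1 q2 /= win q1n.
set q := rcons q1 (f, w).
rewrite upath_cat => /andP[upq _]; rewrite unzip1_cat cat_path => /andP[smq _].
rewrite unzip2_cat mem_cat negb_or cat_uniq => /and3P[/andP[uq _] uqq _].
set s := unzip2 q1.
have Es : unzip2 q = rcons s w by rewrite /q /unzip2 map_rcons.
move: uq uqq; rewrite Es mem_rcons inE negb_or rcons_uniq => /andP[uw us] /andP[ws uqs].
have sdis : ~~ has [in unzip2 (A ++ B)] s.
  apply: contra q1n => /hasP[z /mapP[x xq ->] xin]; by apply/hasP; exists x.
have [rq Eq] : exists rq, unzip1 q = rcons rq f by rewrite /q /unzip1 map_rcons; eexists.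
case Eq' : (unzip1 q) => [|f1 rq1]; first by move: Eq'; rewrite Eq; case: (rq).
have lf : last f1 rq1 = f by rewrite -[last _ _]/(last f (f1 :: rq1)) -Eq' Eq last_rcons.
(* Common to both orientations: [C] leads from [v] to [u], [D] from [u] back to [v], and [w] lies on
   [D]. If [w = v], the edge [f] closes the new loop, hence the smoothness required with its first
   edge [c]. *)
have main C D c rC d rD : loop_at v (C ++ D) -> unzip1 C = c :: rC -> unzip1 D = d :: rD ->
    u = last v (unzip2 C) -> cusp (last c rC) d -> path smooth (last c rC) (unzip1 q) ->
    unzip2 (C ++ D) =i unzip2 (A ++ B) -> w \in unzip2 D -> (w = v -> smooth f c) ->
    exists p, loop_at v p /\ cusps (unzip1 p) < cusps (unzip1 (C ++ D)).
  move=> lpCD EC ED uC cd smCq eqi wD wv.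
  have hD : has [pred x | x.2 == w] D.
    by case/mapP: wD => x xD ->; apply/hasP; exists x => /=.
  case/split_find: hD lpCD eqi ED => -[b w'] D1 D2 /= /eqP-> _ lpCD eqi ED.
  set B1 := rcons D1 (b, w) in lpCD ED *.
  have [rB1 EB1] : exists rB1, unzip1 B1 = d :: rB1.
    move: ED; rewrite unzip1_cat /B1 /unzip1 map_rcons.
    by case: (map _ D1) => [|d' ?] /= [<- _]; eexists.
  exists (C ++ q ++ D2); apply: (loop_reroute (u := u) lpCD EC EB1 cd uC _ upq Eq' Es smCq uqs).
  - by rewrite /B1 /unzip2 map_rcons last_rcons.
  - apply: contra sdis => /hasP[z zs zin]; apply/hasP; exists z => //=; rewrite -eqi; exact: zin.
  move=> D20; rewrite lf; apply: wv.
  move: lpCD => /andP[/and4P[_ _ /eqP lv _] _]; rewrite -lv D20 cats0 /B1.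
  by rewrite unzip2_cat last_cat /unzip2 map_rcons last_rcons.
(* The given orientation works if [w] is on [B], except when [w = v] and [f] forms a cusp with [a];
   the remaining cases go to the reversed loop. *)
have [wB|wB] := boolP ((w \in unzip2 B) && ((w == v) ==> smooth f a)).
  case/andP: wB => wB /implyP wv.
  by apply: main lp EA EB _ gh smq _ wB _ => // /eqP.
have [p' [lp' E1 E2]] := loop_rev lp.
have /andP[/and4P[_ _ /eqP lv uAB] se] := lp.
rewrite !unzip1_cat rev_cat in E1; rewrite unzip2_cat belast_cat -/u rev_cat in E2.
have bA : belast v (unzip2 A) != [::] by case: (A) EA.
set n := size B; have C1 : unzip1 (take n p') = rev (unzip1 B).
  by rewrite /unzip1 map_take -/(unzip1 p') E1 take_size_cat // size_rev size_map.
have D1 : unzip1 (drop n p') = rev (unzip1 A).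
  by rewrite /unzip1 map_drop -/(unzip1 p') E1 drop_size_cat // size_rev size_map.
have C2 : unzip2 (take n p') = rev (belast u (unzip2 B)).
  by rewrite /unzip2 map_take -/(unzip2 p') E2 take_size_cat // size_rev size_belast size_map.
have D2 : unzip2 (drop n p') = rev (belast v (unzip2 A)).
  by rewrite /unzip2 map_drop -/(unzip2 p') E2 drop_size_cat // size_rev size_belast size_map.
have vB : v \in unzip2 B.
  rewrite -lv unzip2_cat last_cat; case: (B) EB => //= -[? ?] ? _; exact: mem_last.
(* If [f] formed a cusp with both end edges of the loop at [v], these would form a cusp with each
   other. *)
have wv : w = v -> smooth f (last h rB).
  move=> wv; move: wB; rewrite wv eqxx vB /= => fa; apply/negP => fh.
  move: se; rewrite unzip1_cat EA EB /= last_cat /= => /negP; apply.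
  by rewrite cusp_sym in fh; apply: cusp_trans fh _; rewrite negbK in fa.
rewrite EA rev_cons_last in D1; rewrite EB rev_cons_last in C1.
rewrite -(cat_take_drop n p') in lp'.
have [p [lpp le]] : exists p, loop_at v p /\
    cusps (unzip1 p) < cusps (unzip1 (take n p' ++ drop n p')).
  apply: main lp' C1 D1 _ _ _ _ _ wv; rewrite ?last_rev_belast 1?cusp_sym //.
  - by rewrite C2; case: (B) EB => //= -[? ?] ? _; rewrite rev_cons last_rcons.
  (* Since [g] and [h] form a cusp, [q] continues smoothly from [h] as it does from [g]. *)
  - move: smq; rewrite Eq' /= => /andP[gf ->]; rewrite andbT.
    by apply: contra gf; apply: cusp_trans.
  - move=> z; rewrite cat_take_drop E2 -rev_cat mem_rev -belast_cat -unzip2_cat.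
    exact: (perm_mem (belast_perm lv)).
  rewrite D2 mem_rev.
  have : w \in rcons (belast v (unzip2 A)) u.
    rewrite -lastI inE; case: eqVneq => //= wv'.
    move: win wB; rewrite unzip2_cat mem_cat (negbTE wv') andbT.
    by case/orP=> // ->.
  rewrite mem_rcons inE => /orP[/eqP wu|//].
  by rewrite wu eqxx in uw.
exists p; split=> //; apply: leq_trans le _.
by rewrite cat_take_drop E1 -rev_cat cusps_rev unzip1_cat.
Qed.


(** * Vertices reachable smoothly from an edge *)

Definition reach v e : {set vertex G} :=
  [set u | [exists n : 'I_#|vertex G|.+1, exists p : n.-tuple (edge G * vertex G),
     [&& upath v p, path smooth e (unzip1 p), uniq (v :: unzip2 p) & u \in unzip2 p]]].

(** The bound on the length makes membership decidable and loses nothing, because the vertices of a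
    witness are distinct. *)
Lemma reachP v e u :
  reflect (exists p, [/\ upath v p, path smooth e (unzip1 p), uniq (v :: unzip2 p)
                       & u \in unzip2 p])
          (u \in reach v e).
Proof.
rewrite inE; apply: (iffP existsP) => [[n /existsP[p /and4P[? ? ? ?]]]|[p [? ? up ?]]].
  by exists p.
have sp : size p < #|vertex G|.+1.
  have /card_uniqP := up; rewrite /= size_map => E.
  by rewrite ltnS ltnW // -E max_card.
by exists (Ordinal sp); apply/existsP; exists (in_tuple p); apply/and4P.
Qed.

(** Prefixing [A] to a witness from [u] gives a witness from [v], unless the former meets [v] or
    [A]. The inclusion is strict because [A] reaches [u], whereas a witness starting at [u] never
    returns to it. *)
Lemma reach_proper v e A a rA :
  let u := last v (unzip2 A) in
  upath v A -> path smooth e (unzip1 A) -> uniq (v :: unzip2 A) ->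
  unzip1 A = a :: rA ->
  reach u (last a rA) \proper reach v e \/
  exists q, [/\ upath u q, path smooth (last a rA) (unzip1 q), uniq (u :: unzip2 q)
              & has [in v :: unzip2 A] (unzip2 q)].
Proof.
move=> u upA smA uA EA.
have [/subsetP sub|/subsetPn[t /reachP[q [uq smq uuq tq]] tn]] :=
    boolP (reach u (last a rA) \subset reach v e).
  left; apply/properP; split; first exact/subsetP.
  have uinA : u \in unzip2 A.
    by rewrite /u; case: (A) EA => //= -[? ?] ? _; exact: mem_last.
  exists u; first by apply/reachP; exists A.
  by apply/reachP => -[q [_ _ /= /andP[/negP un _] ?]].
right; exists q; split=> //; apply: contraR tn => hq; apply/reachP; exists (A ++ q).
rewrite upath_cat upA uq unzip1_cat unzip2_cat mem_cat tq orbT; split=> //.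
  by rewrite cat_path smA EA.
by rewrite -cat_cons cat_uniq uA hq; move: uuq => /= /andP[].
Qed.

Lemma no_self_arrow e x : src e = Some x -> tgt e = Some x -> False.
Proof.
move=> sx tx; case: netG => -[/(_ [:: x]) ac _] _.
by have // : [:: x] = [::]; apply: ac; rewrite /= andbT; apply/existsP; exists e;
  rewrite sx tx eqxx.
Qed.

Lemma path_first_cusp a r : ~~ path smooth a r -> exists r1 h r2,
  [/\ r = r1 ++ h :: r2, path smooth a r1 & cusp (last a r1) h].
Proof.
elim: r a => //= f r IH a; rewrite negb_and negbK; have [c|s /= /IH] := boolP (cusp a f).
  by exists [::], f, r.
by move=> [r1 [h [r2 [-> p c]]]]; exists (f :: r1), h, r2; rewrite /= /smooth s p c.
Qed.

(** * Existence of a terminal vertex that is a par or splitting *)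

Definition terminal v : bool := [forall c, (src c == Some v) ==> (tgt c == None)].

Definition avoid v : rel (vertex G) :=
  fun x y => [&& x != v, y != v & [exists e, joins e x y]].

(** A premise without source imposes no condition; in particular a vertex without premises, such as
    an axiom, is splitting. *)
Definition splitting v : bool :=
  [forall l, forall r, forall x, forall y,
    [&& l != r, tgt l == Some v, tgt r == Some v, src l == Some x & src r == Some y]
    ==> ~~ connect (avoid v) x y].

Lemma avoid_upath v x (s : seq (vertex G)) : path (avoid v) x s ->
  exists p, [/\ upath x p, unzip2 p = s & v \notin s].
Proof.
elim: s x => [|y s IH] x /=; first by exists [::].
case/andP=> /and3P[_ yv /existsP[e je]] /IH[p [up E vs]].
by exists ((e, y) :: p); rewrite /= je up E inE negb_or eq_sym yv vs.
Qed.

(** A simple path avoiding [v] between the sources of two premises closes up through [v], smoothly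
    since [v] is not a par. *)
Lemma not_splitting_loop v : ~~ splitting v -> ~~ is_parr v -> exists p, loop_at v p.
Proof.
case/forallPn=> l /forallPn[r /forallPn[x /forallPn[y]]].
rewrite negb_imply negbK => /andP[/and5P[lr /eqP tl /eqP tr /eqP sl /eqP sr] con] np.
case/connectP: con => s0 /shortenP[s ps us _] E.
have [p [up Ep vs]] := avoid_upath ps.
have xv : x != v by apply/eqP => xv; apply: (no_self_arrow sl); rewrite xv.
exists ((l, x) :: rcons p (r, v)); apply/andP; split.
  apply/and4P; split=> //=.
  - rewrite -cats1 upath_cat up /= Ep -E andbT /joins sl tl sr tr !eqxx ?orbT //.
  - by rewrite /unzip2 map_rcons last_rcons.
  rewrite /unzip2 map_rcons -/(unzip2 p) Ep rcons_uniq mem_rcons inE negb_or xv vs /=.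
  by move: us.
by rewrite /= /unzip1 map_rcons last_rcons /smooth /cusp negb_or eq_sym lr tl tr (negbTE np) andbF.
Qed.

(** The other endpoints [a] of [g] and [b] of [h] differ: otherwise a vertex would repeat, or the
    loop would consist of [g] and [h] alone and have a cusp at [v]. So [g] and [h] are distinct
    edges with only [u] in common, and [u] is their shared target. *)
Lemma cusp_tgt v A g u h b B :
  loop_at v (rcons A (g, u) ++ (h, b) :: B) -> cusp g h -> tgt g = Some u.
Proof.
case/andP=> /and4P[_]; rewrite cat_rcons upath_cat /= => /andP[_ /and3P[jg jh _]].
rewrite !unzip2_cat /= last_cat /= => /eqP lv uq se gh.
set a := last v (unzip2 A) in jg.
have ub : u <> b.
  by move=> ub; move: uq; rewrite cat_uniq /= ub inE eqxx /= !andbF.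
have ab : a <> b.
  move=> ab; case: (lastP A) @a jg ab lv uq se => [|A' [a1 x1]] a jg ab lv uq se.
    case/lastP: B lv uq se => [|B [? ?]] /=.
      by move=> _ _; rewrite /smooth cusp_sym gh.
    rewrite /unzip2 map_rcons last_rcons => ->; rewrite [v]ab.
    by rewrite /= mem_rcons inE eqxx /= andbF.
  move: uq; rewrite -ab /a /unzip2 map_rcons last_rcons cat_uniq => /and3P[_ /hasPn/(_ x1)].
  by rewrite !inE eqxx mem_rcons inE eqxx orbT /= => /(_ isT).
case/cuspP: gh => [E|[z zg zh]].
  by rewrite -E in jh; case: (joins_inj jg jh) => -[]; congruence.
by case: (joins_tgt jg zg) => E; case: (joins_tgt jh zh) => E'; congruence.
Qed.

Lemma terminal_splitting e v : tgt e = Some v ->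
  exists2 w, terminal w & is_parr w || splitting w.
Proof.
have [n] := ubnP #|reach v e|; elim: n v e => // n IH v e; rewrite ltnS => le te.
have {le} IH f w : reach w f \proper reach v e -> tgt f = Some w ->
    exists2 w, terminal w & is_parr w || splitting w.
  by move=> /proper_card lt; apply: IH; apply: leq_trans le.
have [tv|] := boolP (terminal v); last first.
  case/forallPn=> f; rewrite negb_imply => /andP[/eqP sf].
  case tf : (tgt f) => [v'|//] _.
  have vv' : v != v' by apply/eqP => E; apply: (no_self_arrow sf); rewrite E.
  have jf : joins f v v' by rewrite /joins sf tf !eqxx.
  case: (@reach_proper v e [:: (f, v')] f [::]) => //=; rewrite ?jf ?andbT //.
  - apply/negP => /cuspP[E|[z]]; first by move: sf; rewrite -E => /no_self_arrow; apply.
    by rewrite te tf => -[<-] [E]; rewrite E eqxx in vv'.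
  - by rewrite inE vv'.
  - by move=> /IH; apply.
  (* The witness can only come back to [v], as its start [v'] is excluded. Cut at its first return,
     it forms with [f] a closed path whose only possible cusp is between its last edge [g] and
     [f]. *)
  case=> q [uq smq /andP[v'q uuq] hq]; exfalso.
  have {hq} hq : has [pred x | x.2 == v] q.
    case/hasP: hq => _ /mapP[x xq ->]; rewrite !inE => /orP[xv|/eqP xv'].
      by apply/hasP; exists x.
    by case/negP: v'q; rewrite -xv'; apply: map_f.
  case/split_find: hq uq smq v'q uuq => -[g w] q1 q2 /= /eqP-> q1n {w}.
  rewrite upath_cat => /andP[up _]; rewrite unzip1_cat cat_path => /andP[sm _].
  rewrite unzip2_cat mem_cat negb_or cat_uniq => /andP[v'q _] /andP[uq _].
  have cl : closed_path v ((f, v') :: rcons q1 (g, v)).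
    by rewrite /closed_path /= jf up v'q uq /unzip2 map_rcons last_rcons eqxx.
  apply/negP: (closed_path_cusp cl); rewrite negbK /= rcons_path sm /=.
  move: sm up v'q; rewrite /unzip1 /unzip2 !map_rcons last_rcons rcons_path mem_rcons inE negb_or.
  case/andP=> _ fg; rewrite -cats1 upath_cat => /andP[_ /= /andP[jg _]] /andP[_ v'q].
  (* Such a cusp forces [g] to leave from [v'], so [q1] is empty and [g] directly follows [f], which
     contradicts smoothness. *)
  apply/negP => gf; have E : last v' (unzip2 q1) = v'.
    case/cuspP: gf => [E|[z zg zf]].
      rewrite E in jg; case: (joins_inj jf jg) => -[] //.
      by move=> _ E'; rewrite E' eqxx in vv'.
    rewrite tf in zf; case: zf zg => <- zg; case: (joins_tgt jg zg) => // E'.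
    by rewrite E' eqxx in vv'.
  move: fg; have -> : q1 = [::].
    case/lastP: (q1) E v'q => // q1' [? x]; rewrite /unzip2 map_rcons last_rcons /= => ->.
    by rewrite mem_rcons inE eqxx.
  by rewrite /= /smooth cusp_sym gf.
have [pv|np] := boolP (is_parr v); first by exists v; rewrite ?pv.
have [sp|nsp] := boolP (splitting v); first by exists v; rewrite ?sp ?orbT.
have [p lp] := not_splitting_loop nsp np.
(* Minimality of the number of cusps is obtained as an inner induction on this number. *)
have [m] := ubnP (cusps (unzip1 p)); elim: m p lp => // m IHm p lp; rewrite ltnS => le.
(* Up to reversal the loop starts smoothly after [e]: if its first and last edges both formed a cusp
   with [e], they would form one together at [v]. *)
have {p lp le} [[|[a x] p] [lp sea le]] : exists p, [/\ loop_at v p,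
    ~~ (if unzip1 p is a :: _ then cusp e a else true) & cusps (unzip1 p) <= m].
  case E : (unzip1 p) le => [|a r] le; first by move: lp; rewrite /loop_at E andbF.
  have [c|c] := boolP (cusp e a); last by exists p; rewrite E.
  have [p' [lp' E' _]] := loop_rev lp; exists p'; split=> //.
    rewrite E' E rev_cons_last; apply: contraTN lp => c'.
    rewrite /loop_at E /= /smooth negb_and negbK orbC.
    by rewrite cusp_sym in c'; rewrite (cusp_trans c' c).
  by rewrite E' cusps_rev E.
- by [].
have /andP[cl se] := lp; rewrite /= in sea se.
have [smp|/path_first_cusp[r1 [h [r2 [E sm1 gh]]]]] := boolP (path smooth a (unzip1 p)).
  by case/negP: (closed_path_cusp cl); rewrite /= rcons_path smp se.
(* The loop is cut at its first cusp: [(a, x) :: A] ends with the first edge of the cusp and [B]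
   starts with the second, [h]. *)
pose A := take (size r1) p; pose B := drop (size r1) p.
have EA : unzip1 A = r1 by rewrite /unzip1 map_take -/(unzip1 p) E take_size_cat.
have EB : unzip1 B = h :: r2 by rewrite /unzip1 map_drop -/(unzip1 p) E drop_size_cat.
have EAB : (a, x) :: p = ((a, x) :: A) ++ B by rewrite /= cat_take_drop.
rewrite EAB in lp le.
have /andP[/and4P[_ upp /eqP lv uq] _] := lp.
have vB : v \in unzip2 B.
  by rewrite -lv unzip2_cat last_cat; case: (B) EB => //= -[? ?] ? _; exact: mem_last.
have uA : uniq (v :: unzip2 ((a, x) :: A)).
  move: uq; rewrite unzip2_cat cat_uniq => /and3P[uA /hasPn/(_ v vB) vA _].
  by rewrite cons_uniq uA andbT.
move: (upp); rewrite upath_cat => /andP[upA upB].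
case: (@reach_proper v e ((a, x) :: A) a r1) => //; rewrite ?EA //.
- by rewrite /= EA /smooth sea.
- by rewrite /= EA.
- move=> /IH; apply; set A1 := (a, x) :: A in EA lp *.
  have EA1 : unzip1 A1 = a :: r1 by rewrite /= EA.
  case: (lastP A1) EA1 lp => // A0 [g u] EA1; case: (B) EB => // -[h1 b] B1 [-> _] lp.
  have -> : last a r1 = g.
    by rewrite -[last a r1]/(last a (a :: r1)) -EA1 /unzip1 map_rcons last_rcons.
  rewrite /unzip2 map_rcons last_rcons; apply: cusp_tgt lp _.
  move: gh; rewrite -[last a r1]/(last a (a :: r1)) -EA1 /unzip1 map_rcons last_rcons.
  by [].
case=> q [uq' smq uuq hq].
have {hq} hq : has [in unzip2 (((a, x) :: A) ++ B)] (unzip2 q).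
  apply: sub_has hq => z; rewrite unzip2_cat => zA.
  have {zA} : z \in v :: unzip2 ((a, x) :: A) by []; rewrite in_cons => zA.
  suff : z \in unzip2 ((a, x) :: A) ++ unzip2 B by [].
  by rewrite mem_cat; case/orP: zA => [/eqP->|->//]; rewrite vB orbT.
case Eq : (unzip1 q) => [|f rq]; first by move: Eq hq; case: (q).
have EA1 : unzip1 ((a, x) :: A) = a :: r1 by rewrite /= EA.
have [p' [lp' lt]] := loop_reduce lp EA1 EB gh uq' Eq smq uuq hq.
exact: IHm lp' (leq_trans lt le).
Qed.

End Paths.

(** * Isomorphisms and desequentialization *)

Section Iso.
Variable atom : Type.
Implicit Types G H K : pgraph atom.

(** The maps are exposed so that the images of principal edges can be followed through the rules. *)
Definition is_iso G H (f : vertex G -> vertex H) (g : edge G -> edge H) : Prop :=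
  [/\ bijective f /\ bijective g,
      forall e, src (g e) = omap f (src e) /\ tgt (g e) = omap f (tgt e),
      forall v, vlab (f v) = vlab v,
      forall e, elab (g e) = elab e
    & forall v e, vlab v = v_tens \/ vlab v = v_parr ->
        e \in premises v -> eleft (g e) = eleft e].

Lemma is_iso_trans G H K f g f' g' :
  @is_iso G H f g -> @is_iso H K f' g' -> is_iso (f' \o f) (g' \o g).
Proof.
case=> -[bf bg] st lv le ll [[bf' bg'] st' lv' le' ll']; split=> /=.
- by split; apply: bij_comp.
- by move=> e; case: (st' (g e)) (st e) => -> -> [-> ->]; case: (src e); case: (tgt e).
- by move=> v; rewrite lv' lv.
- by move=> e; rewrite le' le.
- move=> v e h; rewrite inE => /eqP te; rewrite (ll' (f v)) ?lv //; last first.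
    by case: (st e) => _; rewrite inE te => ->.
  by apply: ll h _; rewrite inE te.
Qed.

Lemma isomorphic_trans G H K : isomorphic G H -> isomorphic H K -> isomorphic G K.
Proof.
by move=> [f [g i]] [f' [g' i']]; exists (f' \o f), (g' \o g); apply: is_iso_trans i i'.
Qed.

Lemma is_iso_sym G H f g : @is_iso G H f g -> exists f' g',
  [/\ @is_iso H G f' g', cancel g g' & cancel g' g].
Proof.
case=> -[[f' fK f'K] [g' gK g'K]] st lv le ll; exists f', g'; split=> //.
have st' e : src (g' e) = omap f' (src e) /\ tgt (g' e) = omap f' (tgt e).
  case: (st (g' e)); rewrite g'K => -> ->.
  by case: (src _) => [x|]; case: (tgt _) => [y|] //=; rewrite !fK.
split=> //.
- by split; [exists f | exists g].
- by move=> v; rewrite -{2}[v]f'K lv.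
- by move=> e; rewrite -{2}[e]g'K le.
move=> v e h; rewrite inE => /eqP te; rewrite -{2}[e]g'K (ll (f' v)) //.
  by rewrite -lv f'K.
by rewrite inE; case: (st' e) => _ ->; rewrite te.
Qed.

Lemma inj_surj_bij (A B : finType) (f : A -> B) :
  injective f -> (forall y, exists x, f x = y) -> bijective f.
Proof.
move=> fi fs; have fs' y : exists x, f x == y by case: (fs y) => x <-; exists x.
exists (fun y => xchoose (fs' y)) => [x|y]; last exact/eqP/(xchooseP (fs' y)).
by apply: fi; apply/eqP/(xchooseP (fs' (f x))).
Qed.

Definition sum_map A B A' B' (f : A -> A') (g : B -> B') (x : A + B) : A' + B' :=
  match x with inl a => inl (f a) | inr b => inr (g b) end.

Lemma sum_map_bij A B A' B' (f : A -> A') (g : B -> B') :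
  bijective f -> bijective g -> bijective (sum_map f g).
Proof.
move=> [f' fK f'K] [g' gK g'K]; exists (sum_map f' g').
  by case=> x /=; rewrite ?fK ?gK.
by case=> x /=; rewrite ?f'K ?g'K.
Qed.

Lemma omap_bij A B (f : A -> B) : bijective f -> bijective (omap f).
Proof. by case=> f' fK f'K; exists (omap f') => -[x|] //=; rewrite ?fK ?f'K. Qed.

Lemma is_iso_union G G' H H' f g f' g' :
  @is_iso G H f g -> @is_iso G' H' f' g' ->
  @is_iso (g_union G G') (g_union H H') (sum_map f f') (sum_map g g').
Proof.
case=> -[bf bg] st lv le ll [[bf' bg'] st' lv' le' ll']; split.
- by split; apply: sum_map_bij.
- case=> e /=; [case: (st e) | case: (st' e)] => -> ->.
    by case: (src e); case: (tgt e).
  by case: (src e); case: (tgt e).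
- by case.
- by case.
case=> v [] e h; rewrite !inE /=; case te : (tgt e) => [w|] //= /eqP[E];
  [apply: (ll v) | apply: (ll' v)] => //; by rewrite inE te E.
Qed.

Lemma is_iso_bin k C G H f g l r : @is_iso G H f g ->
  @is_iso (g_bin k C l r) (g_bin k C (g l) (g r)) (omap f) (omap g).
Proof.
case=> -[bf bg] st lv le ll; split.
- by split; apply: omap_bij.
- case=> [e|] //=; case: (st e) => -> ->; rewrite !(inj_eq (bij_inj bg)).
  by split; [case: (src e) | case: ifP => //; case: (tgt e)].
- by case.
- by case.
case=> [v|] [e|] h //=; rewrite inE /= !(inj_eq (bij_inj bg)).
  case: (e == l) => //; case: (e == r) => //=; case te: (tgt e) => [w|] //= /eqP[wv].
  by apply: ll h _; rewrite inE te wv.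
by case: (e == l) => //; case: (e == r) => //=; case: (tgt e).
Qed.

Lemma is_iso_cut G H f g e1 e2 : @is_iso G H f g ->
  @is_iso (g_cut e1 e2) (g_cut (g e1) (g e2)) (omap f) g.
Proof.
case=> -[bf bg] st lv le ll; split.
- by split=> //; apply: omap_bij.
- move=> e /=; case: (st e) => -> ->; rewrite !(inj_eq (bij_inj bg)).
  by split; [case: (@src _ G e) | case: ifP => //; case: (@tgt _ G e)].
- by case.
- by [].
case=> [v|] e h /=; rewrite ?inE /=; last by case: h.
case: ifP => // _; case te: (@tgt _ G e) => [w|] //= /eqP[wv].
by apply: ll h _; rewrite inE te wv.
Qed.

(** * Conclusion edges of a desequentialization *)

Lemma concl_lab Gam (pi : deriv Gam) i : @elab atom (deseq pi) (concl (deseq pi) i) = Gam i.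
Proof.
elim: pi i => {Gam} //=.
- by move=> Gam Del i j _ p IHp q IHq [[x ?]|[x ?]] /=.
- by move=> Gam Del i j p IHp q IHq [[[x ?]|[x ?]]|] /=.
- by move=> Gam i j ij p IHp [[x ?]|] /=.
- by move=> Gam Del p IHp q IHq [x|x] /=.
Qed.

(** In every rule the edges that acquire a target are exactly those of the principal occurrences,
    which leave the sequent. *)
Lemma concl_surj Gam (pi : deriv Gam) (e : @edge atom (deseq pi)) :
  tgt e = None -> exists i, concl (deseq pi) i = e.
Proof.
elim: pi e => {Gam} //=.
- by move=> A e _; exists e.
- move=> Gam Del i j E p IHp q IHq [e|e] /=.
    case: eqP => //= ne; case te: (tgt e) => // _; have [x xe] := IHp e te.
    have xi : x != i by apply: contra_notN ne => /eqP <-; rewrite xe.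
    by exists (inl (exist _ x xi)); rewrite /= xe.
  case: eqP => //= ne; case te: (tgt e) => // _; have [x xe] := IHq e te.
  have xi : x != j by apply: contra_notN ne => /eqP <-; rewrite xe.
  by exists (inr (exist _ x xi)); rewrite /= xe.
- move=> Gam Del i j p IHp q IHq [[e|e]|] /=; last by exists None.
    case: eqP => //= ne; case te: (tgt e) => // _; have [x xe] := IHp e te.
    have xi : x != i by apply: contra_notN ne => /eqP <-; rewrite xe.
    by exists (Some (inl (exist _ x xi))); rewrite /= xe.
  case: eqP => //= ne; case te: (tgt e) => // _; have [x xe] := IHq e te.
  have xi : x != j by apply: contra_notN ne => /eqP <-; rewrite xe.
  by exists (Some (inr (exist _ x xi))); rewrite /= xe.
- move=> Gam i j ij p IHp [e|] /=; last by exists None.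
  case: ifP => //; case te: (tgt e) => // ne _; have [x xe] := IHp e te.
  have xij : (x != i) && (x != j).
    by apply/andP; split; apply: contraFN ne => /eqP <-; rewrite xe eqxx ?orbT.
  by exists (Some (exist _ x xij)); rewrite /= xe.
- move=> Gam Del p IHp q IHq [e|e] /=; case te: (tgt e) => // _.
    by have [x <-] := IHp e te; exists (inl x).
  by have [x <-] := IHq e te; exists (inr x).
- by move=> A e _; exists tt; case: e.
Qed.

(** * Closure of sequentializable graphs under the rules *)

Definition sequentializable G : Prop :=
  exists (Gam : sequent atom) (pi : deriv Gam), isomorphic G (deseq pi).

Lemma sequentializable_iso G H : isomorphic G H -> sequentializable H -> sequentializable G.
Proof. by move=> i [Gam [pi j]]; exists Gam, pi; apply: isomorphic_trans i j. Qed.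

(** This provides the principal occurrence of a rule to be applied at a given conclusion edge of
    [G]. *)
Lemma iso_concl G Gam (pi : deriv Gam) f g e : @is_iso G (deseq pi) f g ->
  tgt e = None -> exists2 i, concl (deseq pi) i = g e & Gam i = elab e.
Proof.
case=> _ st _ le _ te; have [|i Ei] := @concl_surj _ pi (g e).
  by case: (st e) => _ ->; rewrite te.
by exists i => //; rewrite -(concl_lab pi) Ei le.
Qed.

Lemma sequentializable_empty G : (vertex G -> False) -> (edge G -> False) -> sequentializable G.
Proof.
move=> nv ne; exists (seq_empty atom), (r_mix0 atom).
exists (fun v => False_rect _ (nv v)), (fun e => False_rect _ (ne e)).
split=> [|e|v|e|v e]; [|by case: (ne e)|by case: (nv v)|by case: (ne e)|by case: (nv v)].
split; exists (@of_void _) => x; try by case: x.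
  by case: (nv x).
by case: (ne x).
Qed.

Lemma isomorphic_refl G : isomorphic G G.
Proof.
exists id, id; split=> //; first by split; exists id.
by move=> e; case: (src e); case: (tgt e).
Qed.

Lemma sequentializable_ax A : sequentializable (g_ax A).
Proof. by exists (seq_ax A), (r_ax A); apply: isomorphic_refl. Qed.

Lemma sequentializable_hyp A : sequentializable (g_hyp A).
Proof. by exists (seq_single A), (r_hyp A); apply: isomorphic_refl. Qed.

Lemma sequentializable_union G H :
  sequentializable G -> sequentializable H -> sequentializable (g_union G H).
Proof.
move=> [Gam [p [f [g i]]]] [Del [q [f' [g' i']]]].
by exists (seq_cat Gam Del), (r_mix2 p q); exists (sum_map f f'), (sum_map g g');
  apply: is_iso_union.
Qed.

Lemma sequentializable_parr G l r : l != r -> tgt l = None -> tgt r = None ->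
  sequentializable G -> sequentializable (@g_bin atom v_parr (Parr (elab l) (elab r)) G l r).
Proof.
move=> lr tl tr [Gam [p [f [g iso]]]].
have [i ci <-] := iso_concl iso tl; have [j cj <-] := iso_concl iso tr.
(* Equal occurrences would have the same conclusion edge, against the injectivity of [g]. *)
have ij : i != j.
  apply: contra lr => /eqP ij; rewrite ij cj in ci.
  by case: iso => -[_ /bij_inj gi] *; apply/eqP/esym/gi.
exists _, (r_parr ij p); exists (omap f), (omap g) => /=.
by rewrite ci cj; apply: is_iso_bin.
Qed.

Lemma sequentializable_tens G H l r : tgt l = None -> tgt r = None ->
  sequentializable G -> sequentializable H ->
  sequentializable (@g_bin atom v_tens (Tens (elab l) (elab r)) (g_union G H) (inl l) (inr r)).
Proof.
move=> tl tr [Gam [p [f [g iso]]]] [Del [q [f' [g' iso']]]].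
have [i ci Ei] := iso_concl iso tl; have [j cj Ej] := iso_concl iso' tr.
exists _, (@r_tens atom Gam Del i j p q); exists (omap (sum_map f f')), (omap (sum_map g g')).
have := @is_iso_bin v_tens (Tens (elab l) (elab r)) (g_union G H) _ _ _
  (inl l) (inr r) (is_iso_union iso iso').
by rewrite /sum_map -ci -cj -Ei -Ej.
Qed.

Lemma sequentializable_cut G H (l : edge G) (r : edge H) : tgt l = None -> tgt r = None ->
  elab r = dual (elab l) ->
  sequentializable G -> sequentializable H ->
  sequentializable (@g_cut atom (g_union G H) (inl l) (inr r)).
Proof.
move=> tl tr + [Gam [p [f [g iso]]]] [Del [q [f' [g' iso']]]].
have [i ci <-] := iso_concl iso tl; have [j cj <-] := iso_concl iso' tr => E.
exists _, (r_cut E p q); exists (omap (sum_map f f')), (sum_map g g').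
have := @is_iso_cut (g_union G H) _ _ _
  (inl l) (inr r) (is_iso_union iso iso').
by rewrite /sum_map -ci -cj.
Qed.

End Iso.

(** * Subgraphs and removal of a rule *)

Section Restrict.
Variable atom : Type.
Implicit Types G H K : pgraph atom.

Lemma obind_insub_eq (T : eqType) (P : pred T) (o : option T) (x : {x | P x}) :
  (obind insub o == Some x) = (o == Some (val x)).
Proof.
case: o => //= y; apply/eqP/eqP => [|[->]]; last by rewrite valK.
by case: insubP => //= z _ <- [->].
Qed.

(** An endpoint outside [V] becomes [None], so a premise of a deleted vertex turns into a
    conclusion. *)
Definition restrict G (V : pred (vertex G)) (E : pred (edge G)) : pgraph atom :=
  @PGraph atom {v | V v} {e | E e} (fun e => obind insub (src (val e)))
    (fun e => obind insub (tgt (val e))) (fun v => vlab (val v))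
    (fun e => elab (val e)) (fun e => eleft (val e)).

Section Net.
Variables (G : pgraph atom) (V : pred (vertex G)) (E : pred (edge G)).
Hypothesis incident : forall e v, V v -> src e = Some v \/ tgt e = Some v -> E e.
Notation R := (restrict V E).

Lemma premises_restrict (v : vertex R) (e : edge R) :
  (e \in premises v) = (val e \in premises (val v)).
Proof. by rewrite !inE /= obind_insub_eq. Qed.

Lemma conclusions_restrict (v : vertex R) (e : edge R) :
  (e \in conclusions v) = (val e \in conclusions (val v)).
Proof. by rewrite !inE /= obind_insub_eq. Qed.

Lemma set0_restrict (A : {set edge R}) (B : {set edge G}) :
  (forall e, (e \in A) = (val e \in B)) -> B = set0 -> A = set0.
Proof. by move=> h B0; apply/setP => e; rewrite h B0 !inE. Qed.

Lemma set2_restrict (A : {set edge R}) (B : {set edge G}) l r :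
  (forall e, (e \in A) = (val e \in B)) -> (forall e, e \in B -> E e) ->
  B = [set l; r] ->
  exists l' r' : edge R, [/\ val l' = l, val r' = r & A = [set l'; r']].
Proof.
move=> h hB eB; have El : E l by apply: hB; rewrite eB !inE eqxx.
have Er : E r by apply: hB; rewrite eB !inE eqxx orbT.
exists (exist _ l El), (exist _ r Er); split=> //.
by apply/setP => e; rewrite h eB !inE -!val_eqE.
Qed.

(** By [incident], a kept vertex keeps all its premises and conclusions, and typing concerns only
    these. *)
Lemma restrict_well_typed (v : vertex R) : well_typed (val v) -> well_typed v.
Proof.
have hp e : e \in premises (val v) -> E e.
  by rewrite inE => /eqP te; apply: incident (valP v) _; right.
have hc e : e \in conclusions (val v) -> E e.
  by rewrite inE => /eqP te; apply: incident (valP v) _; left.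
have P0 := set0_restrict (premises_restrict v).
have C0 := set0_restrict (conclusions_restrict v).
have P2 l r := set2_restrict (l := l) (r := r) (premises_restrict v) hp.
have C2 l r := set2_restrict (l := l) (r := r) (conclusions_restrict v) hc.
have bin op : well_typed_bin (val v) op -> well_typed_bin v op.
  move=> [l [r [c [ll lr /P2[l' [r' [El Er Ep]]] Ec ec]]]].
  (* The single conclusion is treated as a pair with equal members, so that [C2] applies. *)
  have [|c1 [c2 [E1 E2 Ec']]] := C2 c c; first by rewrite setUid.
  have E12 : c2 = c1 by apply: val_inj; rewrite E1 E2.
  by exists l', r', c1; rewrite /= El Er E1 Ep Ec' E12 setUid.
rewrite /well_typed /=; case: (vlab (\val v)); [| |exact: bin|exact: bin].
  move=> [/P0-> [e [e' [ne /C2[l [r [El Er ->]]] ee]]]]; split=> //.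
  by exists l, r; rewrite -val_eqE /= El Er.
move=> [/C0-> [e [e' [ne /P2[l [r [El Er ->]]] ee]]]]; split=> //.
by exists l, r; rewrite -val_eqE /= El Er.
Qed.

Lemma joins_restrict (e : edge R) (x y : vertex R) :
  joins e x y = joins (val e) (val x) (val y).
Proof. by rewrite /joins /= !obind_insub_eq. Qed.

Definition forget (p : seq (edge R * vertex R)) : seq (edge G * vertex G) :=
  [seq (val i.1, val i.2) | i <- p].

Lemma unzip1_forget p : unzip1 (forget p) = map val (unzip1 p).
Proof. by rewrite /unzip1 /forget -!map_comp. Qed.

Lemma unzip2_forget p : unzip2 (forget p) = map val (unzip2 p).
Proof. by rewrite /unzip2 /forget -!map_comp. Qed.

Lemma upath_forget (x : vertex R) (p : seq (edge R * vertex R)) :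
  upath x p = upath (val x) (forget p).
Proof. by elim: p x => //= -[e y] p IH x /=; rewrite IH joins_restrict. Qed.

Lemma upath_endpoint H (x : vertex H) p e :
  upath x p -> e \in unzip1 p -> exists a b : vertex H, joins e a b.
Proof.
elim: p x => //= -[f y] p IH x /= /andP[jf up]; rewrite inE => /orP[/eqP->|].
  by exists x, y.
exact: IH up.
Qed.

(** Directed cycles and switching cycles of the restriction are still such cycles in [G]. *)
Lemma restrict_net : proof_net G -> proof_net R.
Proof.
case=> -[ac wt] net; split; first split.
- move=> p cp; have /ac : cycle (@arrow atom G) (map val p).
    case: p cp => //= x p; rewrite -map_rcons path_map; apply: sub_path => a b /=.
    case/existsP=> e /=; rewrite !obind_insub_eq => h; apply/existsP; by exists (val e).
  by case: p {cp}.
- by move=> v; apply: restrict_well_typed; apply: wt.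
move=> x p /and4P[p0 up /and3P[u1 u2 u3] lp] sw.
apply: (net (val x) (forget p)).
  apply/and4P; split.
  - by case: (p) p0.
  - by rewrite -upath_forget.
  - rewrite /simple_path unzip1_forget unzip2_forget belast_map.
    by rewrite !(map_inj_uniq val_inj) u1 u2.
  - by rewrite unzip2_forget last_map val_eqE.
move=> v e e' pv; rewrite !inE => /eqP te /eqP te' ne [].
rewrite unzip1_forget => /mapP[e1 e1p E1] /mapP[e2 e2p E2].
(* Edges of a path in the restriction have both endpoints kept, hence the par below [e] is kept as
   well. *)
have Vv : V v.
  have [a [b]] := upath_endpoint up e1p.
  rewrite joins_restrict -E1 => /orP[]/andP[_]; rewrite te => /eqP[->]; exact: valP.
apply: (sw (exist _ v Vv) e1 e2) => //.
- by rewrite premises_restrict -E1 inE te.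
- by rewrite premises_restrict -E2 inE te'.
- by apply: contra ne => /eqP E12; rewrite E1 E2 E12.
Qed.

(** Edges are counted too because undoing a hypothesis rule deletes an edge and no vertex. *)
Definition gsize H := #|vertex H| + #|edge H|.

Lemma gsize_restrict : gsize R <= gsize G.
Proof. by rewrite /gsize !card_sig leq_add // max_card. Qed.

Lemma gsize_restrict_vertex v : ~~ V v -> gsize R < gsize G.
Proof.
move=> Vv; rewrite /gsize !card_sig -addSn leq_add ?max_card //.
rewrite -cardsT proper_card //; apply/properP; split; first by apply/subsetP => x; rewrite inE.
by exists v; rewrite ?inE.
Qed.

Lemma gsize_restrict_edge e : ~~ E e -> gsize R < gsize G.
Proof.
move=> Ee; rewrite /gsize !card_sig -addnS leq_add ?max_card //.
rewrite -cardsT proper_card //; apply/properP; split; first by apply/subsetP => x; rewrite inE.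
by exists e; rewrite ?inE.
Qed.
End Net.

(** * Deleting a vertex and putting it back *)

Lemma restrict_incident G (v : vertex G) (E : pred (edge G)) :
  (forall e w, w != v -> src e = Some w \/ tgt e = Some w -> E e) ->
  proof_net G -> proof_net (restrict (predC1 v) E).
Proof. by move=> h; apply: restrict_net => e w; apply: h. Qed.

(** [None] stands for the deleted element, in accordance with the new vertex or edge of [g_cut] and
    [g_bin]. *)
Lemma oapp_val_bij (T : finType) (x : T) (P : pred T) :
  (forall y, P y = (y != x)) -> bijective (oapp (val : {y | P y} -> T) x).
Proof.
move=> hP; apply: inj_surj_bij.
  move=> [y|] [z|] //= E; first by congr Some; apply: val_inj.
    by move: (valP y); rewrite /= E hP eqxx.
  by move: (valP z); rewrite /= -E hP eqxx.
move=> y; have [->|ne] := eqVneq y x; first by exists None.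
have Py : P y by rewrite hP.
by exists (Some (exist _ y Py)).
Qed.

Lemma oapp_val_obind_insub (T : finType) (x : T) (P : pred T) (o : option T) :
  (forall y, P y = (y != x)) -> o != Some x ->
  omap (oapp val x) (omap Some (obind (insub : T -> option {y | P y}) o)) = o.
Proof. by case: o => //= y hP ne; rewrite insubT // hP. Qed.

Lemma is_iso_readd_bin G (v : vertex G) (l r c : edge G)
    (l' r' : edge (restrict (predC1 v) (predC1 c))) :
  val l' = l -> val r' = r -> eleft l -> ~~ eleft r -> premises v = [set l; r] ->
  conclusions v = [set c] -> tgt c = None ->
  @is_iso atom (g_bin (vlab v) (elab c) l' r') G (oapp val v) (oapp val c).
Proof.
move=> El Er ll lr pv cv tc.
have se e : (src e == Some v) = (e == c).
  by have /setP/(_ e) := cv; rewrite !inE.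
have te e : (tgt e == Some v) = (e == l) || (e == r).
  by have /setP/(_ e) := pv; rewrite !inE.
have lrn : r == l = false by apply: contraNF lr => /eqP->.
split.
- by split; apply: oapp_val_bij.
- case=> [e|] /=; last by rewrite tc; have /eqP-> : src c == Some v by rewrite se.
  split; first by rewrite oapp_val_obind_insub // se; apply: (valP e).
  rewrite -!val_eqE /= El Er -te; case: eqP => [Ev|/eqP ne]; first exact: Ev.
  exact/esym/oapp_val_obind_insub.
- by case.
- by case.
case=> [w|] [e|] h; rewrite inE //= -!val_eqE /= El Er.
  by case: ifP => //= /negbT; rewrite negb_or => /andP[/negbTE-> /negbTE->].
(* At the new vertex, [g_bin] overwrites [eleft] on [l] and [r] with the values that [ll] and [lr]
   give in [G]. *)
case: ifP => [_ _|_]; last by case: (obind _ _).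
case: eqP => [E|_]; first exact: etrans (congr1 (@eleft _ G) E) ll.
by case: eqP => // E; apply: etrans (congr1 (@eleft _ G) E) (negbTE lr).
Qed.

Lemma is_iso_readd_cut G (v : vertex G) (l r : edge G)
    (l' r' : edge (restrict (predC1 v) predT)) :
  val l' = l -> val r' = r -> premises v = [set l; r] -> conclusions v = set0 ->
  vlab v = v_cut ->
  @is_iso atom (g_cut l' r') G (oapp val v) val.
Proof.
move=> El Er pv cv lv.
have se e : (src e == Some v) = false.
  by have /setP/(_ e) := cv; rewrite !inE.
have te e : (tgt e == Some v) = (e == l) || (e == r).
  by have /setP/(_ e) := pv; rewrite !inE.
split.
- split; first exact: oapp_val_bij.
  apply: inj_surj_bij; first exact: val_inj.
  by move=> e; exists (exist _ e isT).
- move=> e /=.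
  split; first by rewrite oapp_val_obind_insub ?se.
  rewrite -!val_eqE /= El Er -te; case: eqP => [Ev|/eqP ne]; first exact: Ev.
  exact/esym/oapp_val_obind_insub.
- by case=> //=; rewrite lv.
- by [].
by [].
Qed.

(** * Decomposition of a graph into two disjoint pieces *)

Definition sum_val (A T : Type) (P : pred T) (h : A -> T) (x : A + {x | P x}) : T :=
  match x with inl a => h a | inr y => val y end.

Lemma sum_val_bij (A T : finType) (P : pred T) (h : A -> T) :
  injective h -> (forall x, reflect (exists a, h a = x) (~~ P x)) ->
  bijective (@sum_val A T P h).
Proof.
move=> hi hP; apply: inj_surj_bij.
  move=> [a|y] [b|z] //= E; first by congr inl; apply: hi.
  - have /hP : exists a, h a = val z by exists a.
    by rewrite (valP z).
  - have /hP : exists b, h b = val y by exists b.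
    by rewrite (valP y).
  - by congr inr; apply: val_inj.
move=> y; case Py: (P y); first by exists (inr (exist _ y Py)).
by have /hP[a <-] := negbT Py; exists (inl a).
Qed.

Lemma sum_val_insub (A T : finType) (P : pred T) (h : A -> T) (o : option T) :
  (forall x, o = Some x -> P x) ->
  omap (@sum_val A T P h) (omap inr (obind insub o)) = o.
Proof. by case: o => //= x /(_ x erefl) Px; rewrite insubT. Qed.

(** No edge crosses from [Q] to its complement; an edge without endpoints may be put on either
    side. *)
Definition separates G (Q : pred (vertex G)) (P : pred (edge G)) : Prop :=
  forall e x, src e = Some x \/ tgt e = Some x -> P e = Q x.

Lemma is_iso_split G (Q : pred (vertex G)) (P : pred (edge G)) : separates Q P ->
  @is_iso atom (g_union (restrict Q P) (restrict (predC Q) (predC P))) G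
    (sum_val (val : {x | Q x} -> _)) (sum_val (val : {x | P x} -> _)).
Proof.
have imC (T : finType) (R : pred T) x : reflect (exists a : {x | R x}, val a = x) (~~ predC R x).
  rewrite /= negbK; apply: (iffP idP) => [Rx|[a <-]]; last exact: valP.
  by exists (exist _ x Rx).
move=> sep; split.
- by split; apply: sum_val_bij; try apply: imC; apply: val_inj.
- have inlE (o : option (vertex G)) : (forall x, o = Some x -> Q x) ->
      omap (sum_val (P := predC Q) (val : {x | Q x} -> _)) (omap inl (obind insub o)) = o.
    by case: o => //= x /(_ x erefl) Qx; rewrite insubT.
  case=> e; split; apply/esym;
    [apply: inlE | apply: inlE | apply: sum_val_insub | apply: sum_val_insub];
    move=> x xe; rewrite /= -(sep (val e)) ?(valP e) //;
    by [left | right | exact: (valP e)].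
- by case.
- by case.
by move=> v [].
Qed.

(** Once [v] is deleted, the only possible endpoint of [r] is its source, which splitting keeps out
    of the component of the source of [l]. *)
Lemma splitting_separates G v (E : pred (edge G)) (l r : edge (restrict (predC1 v) E)) :
  splitting v -> l != r -> tgt (val l) = Some v -> tgt (val r) = Some v ->
  exists Q P, [/\ @separates (restrict (predC1 v) E) Q P, P l & ~~ P r].
Proof.
set R := restrict _ _ in l r * => sp lr tl tr.
(* [Q] is the component of the source of [l] without [v]. It is empty if [l] has no source, so [P]
   has to include [l] explicitly. *)
pose Q (y : vertex R) : bool :=
  if src (val l) is Some x then connect (avoid v) x (val y) else false.
pose P (e : edge R) := (e == l) ||
  [exists y : vertex R, ((src e == Some y) || (tgt e == Some y)) && Q y].
have notv (x : vertex R) : val x != v by exact: (valP x).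
have noTgt (e : edge R) x : tgt (val e) = Some v -> tgt e <> Some x.
  by move=> te /eqP; rewrite obind_insub_eq te => /eqP[E']; move: (notv x); rewrite /= -E' eqxx.
have srcV (e : edge R) x : src e = Some x -> src (val e) = Some (val x).
  by move/eqP; rewrite obind_insub_eq => /eqP.
have tgtV (e : edge R) x : tgt e = Some x -> tgt (val e) = Some (val x).
  by move/eqP; rewrite obind_insub_eq => /eqP.
have Qjoin (e : edge R) x y : joins (val e) (val x) (val y) -> Q x -> Q y.
  rewrite /Q; case: (src (val l)) => // z j /connect_trans; apply; apply: connect1.
  by rewrite /avoid (notv x) (notv y); apply/existsP; exists (val e).
exists Q, P; split; last 2 first.
- by rewrite /P eqxx.
- rewrite /P negb_or eq_sym lr /=; apply/existsP => -[y /andP[/orP[]/eqP yr]]; last first.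
    by case: (noTgt r y tr).
  rewrite /Q; case sl : (src (val l)) => [x|//]; apply/negP.
  move/forallP: sp => /(_ (val l))/forallP/(_ (val r))/forallP/(_ x)/forallP/(_ (val y))/implyP.
  by apply; rewrite val_eqE lr tl tr sl (srcV _ _ yr) !eqxx.
move=> e x; rewrite /P; case: eqVneq => [->|ne] ex; rewrite ?orFb.
  case: ex => [sl|]; last by move/(noTgt l x tl).
  by rewrite /Q (srcV _ _ sl) connect0.
apply/existsP/idP => [[y /andP[ey Qy]]|Qx]; last first.
  by exists x; rewrite Qx andbT; case: ex => ->; rewrite eqxx ?orbT.
have [<-//|xy] := eqVneq y x.
apply: (Qjoin e y x _ Qy); rewrite /joins.
case/orP: ey => /eqP ey; case: ex => ex.
- by case/eqP: xy; apply: Some_inj; rewrite -ey.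
- by rewrite (srcV _ _ ey) (tgtV _ _ ex) !eqxx.
- by rewrite (tgtV _ _ ey) (srcV _ _ ex) !eqxx orbT.
- by case/eqP: xy; apply: Some_inj; rewrite -ey.
Qed.

(** Tensor and cut are treated together: in both, [l] and [r] lie in two disjoint pieces, each of
    which is sequentialized on its own. *)
Lemma sequentializable_separated G (l r : edge G) Q P :
  @separates G Q P -> P l -> ~~ P r -> tgt l = None -> tgt r = None ->
  sequentializable (restrict Q P) -> sequentializable (restrict (predC Q) (predC P)) ->
  sequentializable (g_bin v_tens (Tens (elab l) (elab r)) l r) /\
  (elab r = dual (elab l) -> sequentializable (g_cut l r)).
Proof.
move=> sep Pl Pr tl tr S1 S2.
have [f [g [iso gK _]]] := is_iso_sym (is_iso_split sep).
pose l1 : edge (restrict Q P) := exist _ l Pl.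
pose r1 : edge (restrict (predC Q) (predC P)) := exist _ r Pr.
have gl : g l = inl l1 by rewrite -(gK (inl l1)).
have gr : g r = inr r1 by rewrite -(gK (inr r1)).
have tl1 : tgt l1 = None by rewrite /= tl.
have tr1 : tgt r1 = None by rewrite /= tr.
split=> [|lab].
  apply: sequentializable_iso (sequentializable_tens tl1 tr1 S1 S2); exists (omap f), (omap g).
  by have := is_iso_bin v_tens (Tens (elab l) (elab r)) l r iso; rewrite gl gr.
apply: sequentializable_iso (sequentializable_cut tl1 tr1 lab S1 S2); exists (omap f), g.
by have := is_iso_cut l r iso; rewrite gl gr.
Qed.

Lemma isomorphic_sym G H : isomorphic G H -> isomorphic H G.
Proof. by move=> [f [g i]]; have [f' [g' [i' _ _]]] := is_iso_sym i; exists f', g'. Qed.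

(** * Detaching an isolated edge or a terminal axiom *)

Lemma isomorphic_hyp G (e : edge G) : src e = None -> tgt e = None ->
  isomorphic (g_union (g_hyp (elab e)) (restrict predT (predC1 e))) G.
Proof.
move=> se te; exists (sum_val (@of_void _)), (sum_val (fun=> e)); split.
- split; apply: sum_val_bij.
  + by case.
  + by move=> x; constructor; case=> -[].
  + by move=> [] [].
  + by move=> x; rewrite /= negbK; apply: (iffP eqP) => [->|[]//]; exists tt.
- by case=> f /=; rewrite ?se ?te // !sum_val_insub.
- by case.
- by case.
by case=> [[]|v] [f|f] h; rewrite inE.
Qed.

(** No edge enters an axiom vertex and its conclusions have no target, so it forms with them a
    connected component. *)
Lemma isomorphic_ax G (v : vertex G) (e e' : edge G) : terminal v ->
  vlab v = v_ax -> premises v = set0 -> e != e' -> conclusions v = [set e; e'] ->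
  elab e = dual (elab e') ->
  isomorphic (g_union (g_ax (elab e'))
                      (restrict (predC1 v) (fun f => (f != e) && (f != e')))) G.
Proof.
move=> tv lv pv ne cv lab.
have se f : (src f == Some v) = (f == e) || (f == e').
  by have /setP/(_ f) := cv; rewrite !inE.
have te f : (tgt f == Some v) = false by have /setP/(_ f) := pv; rewrite !inE.
have sE (b : bool) : src (if b then e' else e) = Some v.
  by apply/eqP; rewrite se; case: b; rewrite eqxx ?orbT.
have tE (b : bool) : tgt (if b then e' else e) = None.
  by move/forallP: tv => /(_ (if b then e' else e)); rewrite sE eqxx => /eqP.
(* [g_ax] labels [true] by the formula and [false] by its dual, so [true] corresponds to [e']. *)
exists (sum_val (fun=> v)), (sum_val (fun b : bool => if b then e' else e)); split.
- split; apply: sum_val_bij.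
  + by move=> [] [].
  + by move=> x; rewrite /= negbK; apply: (iffP eqP) => [->|[]//]; exists tt.
  + by move=> [] [] // E; move: ne; rewrite E eqxx.
  + move=> x; rewrite negb_and !negbK; apply: (iffP orP) => [|[[] <-]]; [|by right|by left].
    by case=> /eqP->; [exists false | exists true].
- case=> [b|f] /=; first by rewrite sE tE.
  rewrite !sum_val_insub // => x xf; rewrite /=; apply/eqP => xv.
    by move: (te (val f)); rewrite /= xf xv eqxx.
  by have := se (val f); rewrite /= xf xv eqxx; case/andP: (valP f) => /negbTE-> /negbTE->.
- by case=> //=.
- by case=> //= -[].
by move=> [[]|w] [f|f] h; rewrite inE.
Qed.

(** * Sequentialization by induction on the size of the net *)

Lemma net_sequentializable G : proof_net G -> sequentializable G.
Proof.
have [n] := ubnP (gsize G); elim: n G => // n IH G; rewrite ltnS => le net.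
have {}IH H : gsize H < gsize G -> proof_net H -> sequentializable H.
  by move=> lt; apply: IH; apply: leq_trans le.
(* An isolated edge is a hypothesis, combined with the rest of the net by [r_mix2]. *)
have [e /andP[/eqP se /eqP te]|no] := pickP (fun e : edge G => (src e == None) && (tgt e == None)).
  apply: sequentializable_iso (isomorphic_sym (isomorphic_hyp se te))
    (sequentializable_union (sequentializable_hyp _) _).
  apply: IH; first by apply: (gsize_restrict_edge _ (e := e)); rewrite /= eqxx.
  apply: restrict_net net => f v _ h; apply/eqP => fe.
  by move: h; rewrite fe se te; case.
have [v0 _|nov] := pickP (@predT (vertex G)); last first.
  apply: sequentializable_empty => [v|e]; first by have := nov v.
  have := no e; case: (src e) => [v|]; first by have := nov v.
  by case: (tgt e) => [v|//]; have := nov v.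
(* [terminal_splitting] starts from an edge with a target. If there is none, every vertex is
   terminal and, for lack of premises, splitting. *)
have [v tv sp] : exists2 v : vertex G, terminal v & is_parr v || splitting v.
  have [e|not] := pickP (fun e : edge G => tgt e != None).
    by case te : (tgt e) => [v|//] _; apply: terminal_splitting te.
  exists v0; first by apply/forallP => c; have /negbFE-> := not c; rewrite implybT.
  apply/orP; right; apply/forallP => l; apply/forallP => r.
  apply/forallP => x; apply/forallP => y; apply/implyP => /and5P[_ /eqP tl].
  by have := not l; rewrite tl.
have lt E : gsize (restrict (predC1 v) E) < gsize G.
  by apply: (gsize_restrict_vertex _ (v := v)); rewrite /= eqxx.
have termT c : c \in conclusions v -> tgt c = None.
  by rewrite inE => sc; move/forallP: tv => /(_ c); rewrite sc => /eqP.
have premT e : e \in premises v -> tgt e = Some v by rewrite inE => /eqP.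
have noc c e w : conclusions v = [set c] -> w != v ->
    src e = Some w \/ tgt e = Some w -> e != c.
  move=> cv wv h; apply: contra wv => /eqP ec.
  have cc : c \in conclusions v by rewrite cv inE.
  move: h (cc); rewrite ec (termT _ cc) inE; case=> // -> /eqP[->]; exact: eqxx.
have nocP e e' c : premises v = [set e; e'] -> conclusions v = [set c] ->
    e != c /\ e' != c.
  move=> pv cv; have tc : tgt c = None by apply: termT; rewrite cv inE.
  have E f : f \in premises v -> f != c.
    by move/premT => tf; apply/eqP => fc; rewrite fc tc in tf.
  by split; apply: E; rewrite pv !inE eqxx ?orbT.
have tnone (E : pred (edge G)) (e : edge (restrict (predC1 v) E)) :
    val e \in premises v -> tgt e = None.
  by rewrite inE => /eqP te /=; rewrite te /= insubF //= eqxx.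
have split_pieces (H : pgraph atom) Q P : @separates H Q P -> proof_net H -> gsize H < gsize G ->
    sequentializable (restrict Q P) /\ sequentializable (restrict (predC Q) (predC P)).
  move=> sep nH ltH; split; apply: IH; try exact: leq_ltn_trans (gsize_restrict _ _) ltH.
    by apply: restrict_net nH => e w Qw h; rewrite (sep _ _ h).
  by apply: restrict_net nH => e w Qw h; rewrite /= (sep _ _ h).
have [[_ wt] _] := net; move: sp (wt v); rewrite /well_typed /is_parr {wt}.
case lv : (vlab v) => /= sp.
- move=> [pv [e [e' [ne cv lab]]]].
  apply: sequentializable_iso (isomorphic_sym (isomorphic_ax tv lv pv ne cv lab))
    (sequentializable_union (sequentializable_ax _) _).
  apply: IH (lt _) _; apply: restrict_incident net => f w wv h.
  have E c : c \in conclusions v -> f != c.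
    move=> cc; apply: contra wv => /eqP fc.
    move: h (cc); rewrite fc (termT _ cc) inE; case=> // -> /eqP[->]; exact: eqxx.
  by rewrite !E // cv !inE eqxx ?orbT.
- move=> [cv [e [e' [ne pv lab]]]].
  (* [r_cut] wants the right formula to be the dual of the left one, so [e'] is on the left. *)
  pose l : edge (restrict (predC1 v) predT) := exist _ e' isT.
  pose r : edge (restrict (predC1 v) predT) := exist _ e isT.
  have lr : l != r by rewrite -val_eqE eq_sym.
  have pv' : premises v = [set e'; e] by rewrite setUC.
  have lp : val l \in premises v by rewrite pv' !inE eqxx.
  have rp : val r \in premises v by rewrite pv' !inE eqxx orbT.
  have nR : proof_net (restrict (predC1 v) predT) by apply: restrict_incident net.
  have [Q [P [sep Pl Pr]]] := splitting_separates sp lr (premT _ lp) (premT _ rp).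
  have [S1 S2] := split_pieces _ _ _ sep nR (lt _).
  have [_ /(_ lab) S] := sequentializable_separated sep Pl Pr (tnone _ _ lp) (tnone _ _ rp) S1 S2.
  apply: sequentializable_iso S; apply: isomorphic_sym; exists (oapp val v), val.
  exact: is_iso_readd_cut pv' cv lv.
- move=> [e [e' [c [ll lr pv cv lab]]]].
  have [e1 e2] := (nocP _ _ _ pv cv).
  pose l : edge (restrict (predC1 v) (predC1 c)) := exist _ e e1.
  pose r : edge (restrict (predC1 v) (predC1 c)) := exist _ e' e2.
  have nelr : l != r by rewrite -val_eqE; apply: contraNneq lr => /= <-.
  have lp : val l \in premises v by rewrite pv !inE eqxx.
  have rp : val r \in premises v by rewrite pv !inE eqxx orbT.
  have nR : proof_net (restrict (predC1 v) (predC1 c)).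
    by apply: restrict_incident net => f w; apply: noc.
  have [Q [P [sep Pl Pr]]] := splitting_separates sp nelr (premT _ lp) (premT _ rp).
  have [S1 S2] := split_pieces _ _ _ sep nR (lt _).
  have [S _] := sequentializable_separated sep Pl Pr (tnone _ _ lp) (tnone _ _ rp) S1 S2.
  apply: sequentializable_iso S; apply: isomorphic_sym; exists (oapp val v), (oapp val c).
  have tc : tgt c = None by apply: termT; rewrite cv inE.
  have := is_iso_readd_bin (l' := l) (r' := r) erefl erefl ll lr pv cv tc.
  by rewrite lv lab.
- move=> [e [e' [c [ll lr pv cv lab]]]].
  have [e1 e2] := (nocP _ _ _ pv cv).
  pose l : edge (restrict (predC1 v) (predC1 c)) := exist _ e e1.
  pose r : edge (restrict (predC1 v) (predC1 c)) := exist _ e' e2.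
  have nelr : l != r by rewrite -val_eqE; apply: contraNneq lr => /= <-.
  have lp : val l \in premises v by rewrite pv !inE eqxx.
  have rp : val r \in premises v by rewrite pv !inE eqxx orbT.
  have nR : proof_net (restrict (predC1 v) (predC1 c)).
    by apply: restrict_incident net => f w; apply: noc.
  (* The par rule has a single premise, so the whole net without [v] goes to the induction
     hypothesis. *)
  have S := sequentializable_parr nelr (tnone _ _ lp) (tnone _ _ rp) (IH _ (lt _) nR).
  apply: sequentializable_iso S; apply: isomorphic_sym; exists (oapp val v), (oapp val c).
  have tc : tgt c = None by apply: termT; rewrite cv inE.
  have := is_iso_readd_bin (l' := l) (r' := r) erefl erefl ll lr pv cv tc.
  by rewrite lv lab.
Qed.

End Restrict.

Theorem theorem6p1 (atom : Type) (rho : pgraph atom) :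
  proof_net rho ->
  exists (Gam : sequent atom) (pi : deriv Gam), isomorphic rho (deseq pi).
Proof. exact: net_sequentializable. Qed.
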